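(* Let $P_1\subseteq\{1,2,3\}^{k_1}$ and $P_2\subseteq\{1,2,3\}^{k_2}$ be simplifiable SUSPs. Then $P_1\times P_2\subseteq\{1,2,3\}^{k_1+k_2}$ is a simplifiable SUSP.
   Context: Puzzles. For $s,k\in\mathbb{N}$, an $(s,k)$-puzzle is a subset $P\subseteq\{1,2,3\}^k$ with $|P|=s$. The product of puzzles is $P_1\times P_2=\{r_1\circ r_2 : r_1\in P_1,\ r_2\in P_2\}$, where $\circ$ is concatenation. 3D graphs. A 3D graph $H$ with finite domain $U$ is given by an edge set $E(H)\subseteq U^3$ (a 3-uniform hypergraph on three disjoint copies of $U$). Its projections are the 2D graphs $R_0,R_1,R_2$ on $U$ with edge sets $E(R_0)=\{(v,w): \exists u,\ (u,v,w)\in E(H)\}$, $E(R_1)=\{(u,w):\exists v,\ (u,v,w)\in E(H)\}$, $E(R_2)=\{(u,v):\exists w,\ (u,v,w)\in E(H)\}$. The trivial matching on $U$ is $\{(u,u,u):u\in U\}$. Simplification. Let $S\subseteq U$ and $f\in\{0,1,2\}$. $S$ induces a simplification of $R_f$ if $E(R_f)\cap (S\times(U\setminus S))=\emptyset$ or $E(R_f)\cap((U\setminus S)\times S)=\emptyset$. In that case the simplification of $H$ induced by $S$ via $R_f$ is the 3D graph obtained from $H$ by deleting every edge whose projection to $R_f$ (i.e. the pair obtained by dropping the first, second, or third coordinate for $f=0,1,2$ respectively) lies in $(S\times(U\setminus S))\cup((U\setminus S)\times S)$. $H$ simplifies to $H'$ if there is a finite (possibly empty) sequence $H=H_0,H_1,\dots,H_\ell=H'$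 and pairs $(S_j,f_j)$ such that $H_j$ is the simplification of $H_{j-1}$ induced by $S_j$ via the projection $R_{f_j}$ of $H_{j-1}$, for each $1\le j\le \ell$ (projections are recomputed at each step). The graph $H_P$. For a puzzle $P\subseteq\{1,2,3\}^k$, $H_P$ is the 3D graph with domain $P$ in which $(u,v,w)\in P^3$ is an edge if and only if there is no $i\in\{1,\dots,k\}$ such that exactly two of the conditions $u_i=1$, $v_i=2$, $w_i=3$ hold. Simplifiable SUSP. A puzzle $P$ is a simplifiable SUSP (strong uniquely solvable puzzle) if $H_P$ simplifies to the 3D graph whose edge set is the trivial matching $\{(u,u,u):u\in P\}$. *)

(* Defs.v *)
From mathcomp Require Import all_boot.

Set Implicit Arguments.
Unset Strict Implicit.
Unset Printing Implicit Defensive.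

(* A letter of {1,2,3} is an ordinal x : 'I_3 whose value is the letter minus
   one, so that "the letter is c" reads x.+1 == c. *)
Definition word (k : nat) := k.-tuple 'I_3.

Definition puzzle (k : nat) := {set word k}.

Definition puzzle_prod (k1 k2 : nat) (P1 : puzzle k1) (P2 : puzzle k2) :
    puzzle (k1 + k2) :=
  [set cat_tuple r1 r2 | r1 in P1, r2 in P2].

Definition graph2 (U : finType) := {set U * U}.

Definition graph3 (U : finType) := {set U * U * U}.

Definition trivial_matching (U : finType) : graph3 U :=
  [set (u, u, u) | u : U].

Definition drop_coord (U : finType) (f : 'I_3) (e : U * U * U) : U * U :=
  let: (u, v, w) := e in
  match val f with
  | 0 => (v, w)
  | 1 => (u, w)
  | _ => (u, v)
  end.

Definition projection (U : finType) (f : 'I_3) (H : graph3 U) : graph2 U :=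
  [set drop_coord f e | e in H].

Definition induces_simplification (U : finType) (R : graph2 U) (S : {set U}) :
    Prop :=
  R :&: setX S (~: S) = set0 \/ R :&: setX (~: S) S = set0.

Definition simplification (U : finType) (H : graph3 U) (S : {set U})
    (f : 'I_3) : graph3 U :=
  [set e in H | drop_coord f e \notin setX S (~: S) :|: setX (~: S) S].

Inductive simplifies_to (U : finType) (H : graph3 U) : graph3 U -> Prop :=
  | simplifies_refl : simplifies_to H H
  | simplifies_step (H' : graph3 U) (S : {set U}) (f : 'I_3) :
      simplifies_to H H' ->
      induces_simplification (projection f H') S ->
      simplifies_to H (simplification H' S f).

Definition puzzle_dom (k : nat) (P : puzzle k) : finType :=
  {r : word k | r \in P}.

Definition puzzle_graph (k : nat) (P : puzzle k) : graph3 (puzzle_dom P) :=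
  [set e : puzzle_dom P * puzzle_dom P * puzzle_dom P |
    let: (u, v, w) := e in
    ~~ [exists i : 'I_k,
          ((tnth (val u) i).+1 == 1) + ((tnth (val v) i).+1 == 2)
          + ((tnth (val w) i).+1 == 3) == 2]].

Definition simplifiable_SUSP (k : nat) (P : puzzle k) : Prop :=
  simplifies_to (puzzle_graph P) (trivial_matching (puzzle_dom P)).

(* Main.v *)
(* A map p : U -> V sending the edges of H to edges of G lets every
   simplification of G be copied on H, by pulling back the sets S along p; this
   deletes exactly the edges of H whose image under p is deleted from G.  Both
   projections of P1 x P2 onto its factors are such maps: copying first the
   simplification of P1 and then that of P2 leaves only the edges that are
   trivial in both components. *)
Require Import Defs.
From mathcomp Require Import all_boot.

Set Implicit Arguments.
Unset Strict Implicit.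
Unset Printing Implicit Defensive.

Definition map_edge (U V : Type) (p : U -> V) (e : U * U * U) : V * V * V :=
  let: (u, v, w) := e in (p u, p v, p w).

(** Induction on the second derivation, since [simplifies_step] appends a step at the end. *)
Lemma simplifies_trans (U : finType) (G H K : graph3 U) :
  simplifies_to G H -> simplifies_to H K -> simplifies_to G K.
Proof. by move=> GH; elim=> // K' S f _ GK' /(simplifies_step GK'). Qed.

Lemma drop_coord_map (U V : finType) (p : U -> V) (f : 'I_3) e :
  drop_coord f (map_edge p e) =
  (p (drop_coord f e).1, p (drop_coord f e).2).
Proof. by case: e f => [[u v] w] [[|[|f]] Hf]. Qed.

Lemma setX_preim0 (U V : finType) (p : U -> V) (R : graph2 U) (Q : graph2 V)
    (A B : {set V}) :
  {in R, forall x, (p x.1, p x.2) \in Q} -> Q :&: setX A B = set0 ->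
  R :&: setX (p @^-1: A) (p @^-1: B) = set0.
Proof.
move=> RQ /setP QAB; apply/setP=> -[u v]; rewrite !inE.
apply/negP=> /and3P[/RQ Quv Au Bv].
by have := QAB (p u, p v); rewrite !inE Quv Au Bv.
Qed.

Lemma simplifies_pullback (U V : finType) (p : U -> V) (H : graph3 U)
    (G G' : graph3 V) :
  {in H, forall e, map_edge p e \in G} -> simplifies_to G G' ->
  simplifies_to H [set e in H | map_edge p e \in G'].
Proof.
move=> HG; elim=> [|K S f _ HK indS].
  suff -> : [set e in H | map_edge p e \in G] = H by exact: simplifies_refl.
  by apply/setP=> e; rewrite inE andb_idr //; apply: HG.
have -> : [set e in H | map_edge p e \in simplification K S f] =
    simplification [set e in H | map_edge p e \in K] (p @^-1: S) f.
  by apply/setP=> e; rewrite !inE drop_coord_map andbA.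
apply: simplifies_step HK _.
(* The pulled-back projection maps into [projection f K], perhaps not onto it; this suffices, as an
   edge across the pulled-back cut would map to one across the cut of [S]. *)
have RQ : {in projection f [set e in H | map_edge p e \in K],
    forall x, (p x.1, p x.2) \in projection f K}.
  move=> _ /imsetP[e /[!inE]/andP[_ Ke] ->].
  by rewrite -drop_coord_map imset_f.
by case: indS => indS; [left | right]; rewrite -preimsetC;
  apply: setX_preim0 RQ indS.
Qed.

(** A coordinate [i] that forbids the image triple gives the coordinate [h i] that forbids the
    original one. *)
Lemma puzzle_graph_map (k l : nat) (P : puzzle k) (Q : puzzle l)
    (p : puzzle_dom P -> puzzle_dom Q) (h : 'I_l -> 'I_k) :
  (forall u i, tnth (val (p u)) i = tnth (val u) (h i)) ->
  {in puzzle_graph P, forall e, map_edge p e \in puzzle_graph Q}.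
Proof.
move=> ph [[u v] w]; rewrite !inE; apply: contra => /existsP[i].
by rewrite !ph => Hi; apply/existsP; exists (h i).
Qed.

(** A single letter satisfies exactly one of the three conditions, never two. *)
Lemma puzzle_graph_diag (k : nat) (P : puzzle k) (u : puzzle_dom P) :
  (u, u, u) \in puzzle_graph P.
Proof.
by rewrite inE; apply/existsP=> -[i]; case: (tnth _ i) => [[|[|[]]]].
Qed.

Lemma trivial_matchingE (U : finType) (u v w : U) :
  ((u, v, w) \in trivial_matching U) = (u == v) && (u == w).
Proof.
apply/imsetP/andP=> [[x _ [-> -> ->]] //|[/eqP <- /eqP <-]].
by exists u.
Qed.

(** Lets the map to the first factor be defined by reading letters, without choosing a decomposition
    of [r]. *)
Lemma puzzle_prod_fst (k1 k2 : nat) (P1 : puzzle k1) (P2 : puzzle k2) r :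
  r \in puzzle_prod P1 P2 -> [tuple tnth r (lshift k2 i) | i < k1] \in P1.
Proof.
case/imset2P=> r1 r2 Pr1 _ ->.
have -> // : [tuple tnth (cat_tuple r1 r2) (lshift k2 i) | i < k1] = r1.
by apply: eq_from_tnth => i; rewrite tnth_mktuple tnth_lshift.
Qed.

Lemma puzzle_prod_snd (k1 k2 : nat) (P1 : puzzle k1) (P2 : puzzle k2) r :
  r \in puzzle_prod P1 P2 -> [tuple tnth r (rshift k1 i) | i < k2] \in P2.
Proof.
case/imset2P=> r1 r2 _ Pr2 ->.
have -> // : [tuple tnth (cat_tuple r1 r2) (rshift k1 i) | i < k2] = r2.
by apply: eq_from_tnth => i; rewrite tnth_mktuple tnth_rshift.
Qed.

Theorem lemma8 (k1 k2 : nat) (P1 : puzzle k1) (P2 : puzzle k2) :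
  simplifiable_SUSP P1 -> simplifiable_SUSP P2 ->
  simplifiable_SUSP (puzzle_prod P1 P2).
Proof.
move=> simpl1 simpl2; rewrite /simplifiable_SUSP.
pose p1 (u : puzzle_dom (puzzle_prod P1 P2)) : puzzle_dom P1 :=
  exist (fun r => r \in P1) _ (puzzle_prod_fst (valP u)).
pose p2 (u : puzzle_dom (puzzle_prod P1 P2)) : puzzle_dom P2 :=
  exist (fun r => r \in P2) _ (puzzle_prod_snd (valP u)).
have p1E u i : tnth (val (p1 u)) i = tnth (val u) (lshift k2 i).
  exact: tnth_mktuple.
have p2E u i : tnth (val (p2 u)) i = tnth (val u) (rshift k1 i).
  exact: tnth_mktuple.
(* Every index lies in the left or the right block, so the two halves determine the word. *)
have p_inj u v : p1 u = p1 v -> p2 u = p2 v -> u = v.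
  move=> eq1 eq2; apply/val_inj/eq_from_tnth => i.
  by case: (split_ordP i) => j ->; rewrite -?p1E -?p2E ?eq1 ?eq2.
have hom1 := puzzle_graph_map p1E; have hom2 := puzzle_graph_map p2E.
set H := puzzle_graph _ in hom1 hom2 *.
have step1 := simplifies_pullback hom1 simpl1.
set H1 := [set e in H | _] in step1.
(* The second pullback starts from [H1], a subgraph of [H], so [p2] still preserves edges. *)
have hom21 : {in H1, forall e, map_edge p2 e \in puzzle_graph P2}.
  by move=> e; rewrite inE => /andP[He _]; exact: hom2.
have step2 := simplifies_pullback hom21 simpl2.
suff <- : [set e in H1 | map_edge p2 e \in trivial_matching (puzzle_dom P2)] =
    trivial_matching _ by exact: simplifies_trans step1 step2.
apply/setP=> -[[u v] w].
rewrite inE [_ \in H1]inE /map_edge !trivial_matchingE.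
(* Diagonal triples are edges of [H] with diagonal images, so they survive both rounds. *)
apply/idP/idP=> [|/andP[/eqP <- /eqP <-]]; last by rewrite puzzle_graph_diag !eqxx.
case/andP=> /and3P[_ /eqP uv1 /eqP uw1] /andP[/eqP uv2 /eqP uw2].
by rewrite -(p_inj _ _ uv1 uv2) -(p_inj _ _ uw1 uw2) !eqxx.
Qed.
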